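(* Let $R=\prod_{i=1}^nR_i$ be a direct product of rings $R_i$. Then for each $i=1,\ldots,n$, the map $$\mathrm{max.Den}_l(R_i)\to\mathrm{max.Den}_l(R),\quad S_i\mapsto R_1\times\cdots\times S_i\times\cdots\times R_n$$ ($S_i$ in the $i$-th place), is a (well-defined) injection. Moreover, $\mathrm{max.Den}_l(R)=\coprod_{i=1}^n\mathrm{max.Den}_l(R_i)$ in the sense of these injections, i.e. $\mathrm{max.Den}_l(R)$ is the disjoint union of their images: $$\mathrm{max.Den}_l(R)=\{R_1\times\cdots\times S_i\times\cdots\times R_n\mid S_i\in\mathrm{max.Den}_l(R_i),\ i=1,\ldots,n\}.$$ For $S_i\in\mathrm{max.Den}_l(R_i)$ one has $$(R_1\times\cdots\times S_i\times\cdots\times R_n)^{-1}R\simeq S_i^{-1}R_i,\qquad \mathrm{ass}_R(R_1\times\cdots\times S_i\times\cdots\times R_n)=R_1\times\cdots\times\mathrm{ass}_{R_i}(S_i)\times\cdots\times R_n.$$ The core of the left denominator set $R_1\times\cdots\times S_i\times\cdots\times R_n$ of $R$ coincides with the core $S_{i,c}$ of the left denominator set $S_i$ of $R_i$, i.e. $$(R_1\times\cdots\times S_i\times\cdots\times R_n)_c=0\times\cdots\times S_{i,c}\times\cdots\times0.$$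
   Context: Rings are associative with $1\neq0$. A multiplicative subset of a ring $R$ is a subset $S$ closed under multiplication with $1\in S$, $0\notin S$. It is a left Ore set if $Sr\cap Rs\neq\emptyset$ for all $r\in R$, $s\in S$. For such $S$ put $\mathrm{ass}(S)=\mathrm{ass}_R(S):=\{r\in R\mid sr=0\text{ for some }s\in S\}$ (an ideal of $R$). A left Ore set $S$ is a left denominator set if $rs=0$ with $r\in R,s\in S$ implies $r\in\mathrm{ass}(S)$. Then $S^{-1}R=\{s^{-1}r\mid s\in S,r\in R\}$ is the left localization of $R$ at $S$. $\mathrm{max.Den}_l(R)$ is the set of left denominator sets of $R$ that are maximal with respect to inclusion. The core $S_c$ of a left Ore set $S$ of $R$ is the set of all $s\in S$ with $\ker(s\cdot)=\mathrm{ass}(S)$, where $s\cdot:R\to R$, $r\mapsto sr$. *)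

(* Defs.v *)
From HB Require Import structures.
From mathcomp Require Import all_boot all_order all_algebra.
From mathcomp Require Import generic_quotient.
From mathcomp Require Import boolp classical_sets functions.

Set Implicit Arguments.
Unset Strict Implicit.
Unset Printing Implicit Defensive.

Import GRing.Theory.
Local Open Scope classical_set_scope.
Local Open Scope ring_scope.
Local Open Scope quotient_scope.

Section DenominatorSets.
Variable R : nzRingType.
Implicit Type S : set R.

Definition multiplicative_subset S : Prop :=
  [/\ S 1, ~ S 0 & forall s t, S s -> S t -> S (s * t)].

Definition left_ore S : Prop :=
  multiplicative_subset S /\
  forall r s, S s ->
    [set s' * r | s' in S] `&` [set r' * s | r' in [set: R]] !=set0.

Definition ass S : set R := [set r | exists2 s, S s & s * r = 0].

Definition left_denominator_set S : Prop :=
  left_ore S /\ forall r s, S s -> r * s = 0 -> ass S r.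

Definition max_left_den : set (set R) :=
  [set S | left_denominator_set S /\
     forall T, left_denominator_set T -> S `<=` T -> T = S].

Definition ore_core S : set R :=
  [set s | S s /\ [set r | s * r = 0] = ass S].

End DenominatorSets.

Section LeftLocalization.
Variables (R : nzRingType) (S : set R).
Hypothesis denS : left_denominator_set S.

(* The pair (s, r) stands for the left fraction s^-1 r. *)
Definition prefrac : Type := ({s : R | s \in S} * R)%type.

(* s^-1 r = t^-1 u  iff  (c s)^-1 (c r) and (d t)^-1 (d u) are literally the
   same fraction, for some c and d in R with c s = d t in S. *)
Definition frac_rel (x y : prefrac) : Prop :=
  exists c d : R, [/\ S (c * val x.1), c * val x.1 = d * val y.1
                    & c * x.2 = d * y.2].

Lemma left_den1 : S 1. Proof. by case: denS => -[[]]. Qed.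
Lemma left_denM s t : S s -> S t -> S (s * t).
Proof. by case: denS => -[[_ _ h] _] _; apply: h. Qed.

Lemma left_ore_ex (r s : R) : S s ->
  exists cd : R * R, S cd.1 /\ cd.1 * r = cd.2 * s.
Proof.
case: denS => -[_ h] _ /(h r) [_ [[c Sc <-] [d _ e]]].
by exists (c, d).
Qed.

Lemma left_den_cancel (a b s : R) : S s -> a * s = b * s ->
  exists2 k, S k & k * a = k * b.
Proof.
case: denS => _ h Ss e; have [|k Sk ek] := h (a - b) s Ss.
  by rewrite mulrBl e subrr.
by exists k => //; apply/eqP; rewrite -subr_eq0 -mulrBr ek.
Qed.

Lemma prefracP (x : prefrac) : S (val x.1).
Proof. by apply: set_mem; case: x.1. Qed.

Lemma frac_rel_cancel (x y : prefrac) (a b : R) :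
    frac_rel x y -> a * val x.1 = b * val y.1 ->
  exists2 k, S k & k * (a * x.2) = k * (b * y.2).
Proof.
case: x y => [s r] [t u] [p [q [/= Sps eps epr]]] e.
have Ss := prefracP (s, r); have St := prefracP (t, u).
rewrite /= in Ss St e *.
have [[c d] /= [Sc ecd]] := left_ore_ex (a * val s) Sps.
have [k1 Sk1 e1] : exists2 k, S k & k * (c * a) = k * (d * p).
  by apply: (left_den_cancel Ss); rewrite -!mulrA.
have [k2 Sk2 e2] : exists2 k, S k & k * (c * b) = k * (d * q).
  by apply: (left_den_cancel St); rewrite -!mulrA -e ecd eps.
have [[m n] /= [Sm emn]] := left_ore_ex k1 Sk2.
exists (m * k1 * c); first exact: left_denM (left_denM Sm Sk1) Sc.
have -> : m * k1 * c * (a * r) = m * (k1 * (c * a)) * r by rewrite !mulrA.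
rewrite e1; have -> : m * (k1 * (d * p)) * r = m * k1 * d * (p * r).
  by rewrite !mulrA.
rewrite epr emn.
have -> : n * k2 * d * (q * u) = n * (k2 * (d * q)) * u by rewrite !mulrA.
by rewrite -e2 !mulrA.
Qed.

Lemma frac_rel_refl x : frac_rel x x.
Proof. by exists 1, 1; split=> //; rewrite mul1r; apply: prefracP. Qed.

Lemma frac_rel_sym x y : frac_rel x y -> frac_rel y x.
Proof. by move=> [c [d [Sc e1 e2]]]; exists d, c; split; rewrite -?e1. Qed.

Lemma frac_rel_intro (x y : prefrac) (a b k : R) :
    S k -> S (a * val x.1) -> a * val x.1 = b * val y.1 ->
    k * (a * x.2) = k * (b * y.2) -> frac_rel x y.
Proof.
move=> Sk Sa e e2; exists (k * a), (k * b).
by rewrite -!mulrA -e; split=> //; apply: left_denM.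
Qed.

Lemma frac_rel_trans y x z : frac_rel x y -> frac_rel y z -> frac_rel x z.
Proof.
move=> xy yz.
have [[c d] /= [Sc ecd]] := left_ore_ex (val x.1) (prefracP z).
have [[m n] /= [Sm emn]] := left_ore_ex (c * val x.1) (prefracP y).
have [k Sk ek] := frac_rel_cancel xy (etrans (esym (mulrA _ _ _)) emn).
have e' : n * val y.1 = m * d * val z.1 by rewrite -emn ecd mulrA.
have [l Sl el] := frac_rel_cancel yz e'.
have [[p q] /= [Sp epq]] := left_ore_ex k Sl.
apply: (@frac_rel_intro x z (m * c) (m * d) (p * k)).
- exact: left_denM.
- by rewrite -mulrA; do 2?[apply: left_denM => //]; apply: prefracP.
- by rewrite -!mulrA ecd.
- by rewrite -(mulrA p) ek (mulrA p) epq -(mulrA q) el !mulrA.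
Qed.

Definition frac_relb (x y : prefrac) : bool := `[< frac_rel x y >].

Lemma frac_relb_refl : reflexive frac_relb.
Proof. by move=> x; apply/asboolP/frac_rel_refl. Qed.
Lemma frac_relb_sym : symmetric frac_relb.
Proof. by move=> x y; apply/asboolP/asboolP; apply: frac_rel_sym. Qed.
Lemma frac_relb_trans : transitive frac_relb.
Proof.
move=> y x z /asboolP xy /asboolP yz.
exact/asboolP/(frac_rel_trans xy yz).
Qed.

Definition frac_equiv : equiv_rel prefrac :=
  EquivRel frac_relb frac_relb_refl frac_relb_sym frac_relb_trans.

Definition left_loc : Type := {eq_quot frac_equiv}.
HB.instance Definition _ := Choice.on left_loc.
HB.instance Definition _ := EqQuotient.on left_loc.

Definition left_frac (s : R) (Ss : S s) (r : R) : left_loc :=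
  \pi_left_loc ((exist _ s (mem_set Ss), r) : prefrac).

Lemma fracP (x : left_loc) : exists s (Ss : S s) (r : R), x = left_frac Ss r.
Proof.
elim/quotW: x => -[[s ss] r]; exists s, (set_mem ss), r.
rewrite /left_frac; congr (\pi_left_loc _); congr (_, _); exact: val_inj.
Qed.

Lemma frac_eqP s (Ss : S s) r t (St : S t) u :
  left_frac Ss r = left_frac St u <->
  exists c d : R, [/\ S (c * s), c * s = d * t & c * r = d * u].
Proof.
split; last by move=> h; apply/eqquotP/asboolP.
by move=> /eqquotP/asboolP.
Qed.

Lemma frac_eq_cancel s (Ss : S s) r t (St : S t) u a b :
    left_frac Ss r = left_frac St u -> a * s = b * t ->
  exists2 k, S k & k * (a * r) = k * (b * u).
Proof. by move=> /eqquotP/asboolP; apply: frac_rel_cancel. Qed.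

Lemma frac_expand s (Ss : S s) r c (Scs : S (c * s)) :
  left_frac Scs (c * r) = left_frac Ss r.
Proof. by apply/frac_eqP; exists 1, c; rewrite !mul1r. Qed.

Lemma frac_den_eq s (Ss : S s) t (St : S t) r :
  s = t -> left_frac Ss r = left_frac St r.
Proof. by move=> e; apply/frac_eqP; exists 1, 1; rewrite !mul1r e. Qed.

Definition left_ore_pair (r s : R) (Ss : S s) : R * R :=
  sval (cid (left_ore_ex r Ss)).

Lemma left_ore_pair_mem r s (Ss : S s) : S (left_ore_pair r Ss).1.
Proof. by rewrite /left_ore_pair; case: cid => cd []. Qed.
Lemma left_ore_pairE r s (Ss : S s) :
  (left_ore_pair r Ss).1 * r = (left_ore_pair r Ss).2 * s.
Proof. by rewrite /left_ore_pair; case: cid => cd []. Qed.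

Definition den (x : left_loc) : R := val (repr x : prefrac).1.
Definition num (x : left_loc) : R := (repr x : prefrac).2.

Lemma den_mem x : S (den x). Proof. exact: prefracP. Qed.

Lemma frac_num_den x : left_frac (den_mem x) (num x) = x.
Proof.
rewrite -[RHS]reprK /left_frac /num; congr (\pi_left_loc _).
rewrite [RHS]surjective_pairing; congr (_, _); exact: val_inj.
Qed.

(* s^-1 r + t^-1 u = (c s)^-1 (c r + d u),  where c s = d t and c in S. *)
Definition loc_add (x y : left_loc) : left_loc :=
  let cd := left_ore_pair (den x) (den_mem y) in
  left_frac (left_denM (left_ore_pair_mem (den x) (den_mem y)) (den_mem x))
    (cd.1 * num x + cd.2 * num y).

(* (s^-1 r) (t^-1 u) = (c s)^-1 (d u),  where c r = d t and c in S. *)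
Definition loc_mul (x y : left_loc) : left_loc :=
  let cd := left_ore_pair (num x) (den_mem y) in
  left_frac (left_denM (left_ore_pair_mem (num x) (den_mem y)) (den_mem x))
    (cd.2 * num y).

Definition loc_opp (x : left_loc) : left_loc := left_frac (den_mem x) (- num x).

Definition to_loc (r : R) : left_loc := left_frac left_den1 r.

Lemma loc_addE s (Ss : S s) r u :
  loc_add (left_frac Ss r) (left_frac Ss u) = left_frac Ss (r + u).
Proof.
rewrite /loc_add; set x := left_frac Ss r; set y := left_frac Ss u.
set Sp := left_denM _ _; move: Sp.
have := left_ore_pairE (den x) (den_mem y); set cd := left_ore_pair _ _.
case: cd => c d /= e Scx.
have [[p q] /= [Sp epq]] := left_ore_ex (c * den x) Ss.
have [k Sk ek] : exists2 k, S k & k * (p * c * num x) = k * (q * r).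
  by apply: (frac_eq_cancel (frac_num_den x)); rewrite -mulrA.
have [l Sl el] : exists2 l, S l & l * (p * d * num y) = l * (q * u).
  by apply: (frac_eq_cancel (frac_num_den y)); rewrite -mulrA -e.
have [[m n] /= [Sm emn]] := left_ore_ex k Sl.
apply/frac_eqP; exists (m * k * p), (m * k * q); split.
- by do !apply: left_denM => //.
- by rewrite -!(mulrA (m * k)) epq.
- rewrite !mulrDr -!mulrA; congr (_ + _).
    by rewrite -[in RHS]ek !mulrA.
  by rewrite !(mulrA m k) emn -!(mulrA n) -[in RHS]el !mulrA.
Qed.

Lemma loc_mulE s (Ss : S s) r t (St : S t) u c d (Scs : S (c * s)) :
    c * r = d * t ->
  loc_mul (left_frac Ss r) (left_frac St u) = left_frac Scs (d * u).
Proof.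
rewrite /loc_mul; set x := left_frac Ss r; set y := left_frac St u => ecd.
set Sp := left_denM _ _; move: Sp.
have := left_ore_pairE (num x) (den_mem y); set cd := left_ore_pair _ _.
case: cd => c' d' /= e Scx.
have [[a b] /= [Sa eab]] := left_ore_ex (c' * den x) Scs.
have [k Sk ek] : exists2 k, S k & k * (a * c' * num x) = k * (b * c * r).
  by apply: (frac_eq_cancel (frac_num_den x)); rewrite -!mulrA.
have [l Sl el] : exists2 l, S l &
    l * (k * a * d' * num y) = l * (k * b * d * u).
  apply: (frac_eq_cancel (frac_num_den y)).
  by rewrite -!mulrA -e -ecd; move: ek; rewrite -!mulrA.
apply/frac_eqP; exists (l * k * a), (l * k * b); split.
- by do !apply: left_denM => //.
- by rewrite -!(mulrA (l * k)) eab.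
- by move: el; rewrite !mulrA.
Qed.

Arguments loc_mulE {s Ss r t St} u {c d} Scs _.

Lemma loc_oppE s (Ss : S s) r : loc_opp (left_frac Ss r) = left_frac Ss (- r).
Proof.
rewrite /loc_opp; set x := left_frac Ss r.
have /frac_eqP[c [d [Sc e1 e2]]] := frac_num_den x.
by apply/frac_eqP; exists c, d; rewrite !mulrN e2.
Qed.

Lemma frac_common2 (x y : left_loc) : exists s (Ss : S s) (r u : R),
  x = left_frac Ss r /\ y = left_frac Ss u.
Proof.
have [s [Ss [r ->]]] := fracP x; have [t [St [u ->]]] := fracP y.
have [[c d] /= [Sc e]] := left_ore_ex s St.
have Scs := left_denM Sc Ss; have Sdt := Scs; rewrite e in Sdt.
exists (c * s), Scs, (c * r), (d * u); split; first by rewrite frac_expand.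
by rewrite (frac_den_eq Scs Sdt _ e) frac_expand.
Qed.

Lemma frac_common3 (x y z : left_loc) : exists s (Ss : S s) (r u v : R),
  [/\ x = left_frac Ss r, y = left_frac Ss u & z = left_frac Ss v].
Proof.
have [s [Ss [r [u [-> ->]]]]] := frac_common2 x y.
have [t [St [v ->]]] := fracP z.
have [[c d] /= [Sc e]] := left_ore_ex s St.
have Scs := left_denM Sc Ss; have Sdt := Scs; rewrite e in Sdt.
exists (c * s), Scs, (c * r), (c * u), (d * v).
rewrite !frac_expand; split=> //.
by rewrite (frac_den_eq Scs Sdt _ e) frac_expand.
Qed.

Lemma frac0 s (Ss : S s) : left_frac Ss 0 = to_loc 0.
Proof. by apply/frac_eqP; exists 1, s; rewrite !mul1r mulr1 mulr0. Qed.

Lemma loc_addA : associative loc_add.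
Proof.
move=> x y z; have [s [Ss [r [u [v [-> -> ->]]]]]] := frac_common3 x y z.
by rewrite !loc_addE addrA.
Qed.

Lemma loc_addC : commutative loc_add.
Proof.
move=> x y; have [s [Ss [r [u [-> ->]]]]] := frac_common2 x y.
by rewrite !loc_addE addrC.
Qed.

Lemma loc_add0 : left_id (to_loc 0) loc_add.
Proof.
move=> x; have [s [Ss [r ->]]] := fracP x.
by rewrite -(frac0 Ss) loc_addE add0r.
Qed.

Lemma loc_addN : left_inverse (to_loc 0) loc_opp loc_add.
Proof.
move=> x; have [s [Ss [r ->]]] := fracP x.
by rewrite loc_oppE loc_addE addNr frac0.
Qed.

Lemma loc_mulA : associative loc_mul.
Proof.
move=> x y z.
have [s [Ss [r ->]]] := fracP x; have [t [St [u ->]]] := fracP y.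
have [v [Sv [w ->]]] := fracP z.
have [[e f] /= [Se eef]] := left_ore_ex u Sv.
have Set_ := left_denM Se St.
have [[c d] /= [Sc ecd]] := left_ore_ex r Set_.
have Scs := left_denM Sc Ss; have S1cs : S (1 * (c * s)) by rewrite mul1r.
rewrite (loc_mulE w Set_ eef) (loc_mulE (f * w) Scs ecd).
rewrite (loc_mulE (d := d * e) u Scs); last by rewrite ecd mulrA.
rewrite (loc_mulE (c := 1) (d := d * f) w S1cs); last first.
  by rewrite mul1r -!mulrA eef.
rewrite -mulrA.
by apply: frac_den_eq; rewrite mul1r.
Qed.

Lemma loc_mul1 : left_id (to_loc 1) loc_mul.
Proof.
move=> x; have [s [Ss [r ->]]] := fracP x.
have Ss1 : S (s * 1) by rewrite mulr1.
rewrite (loc_mulE (c := s) (d := 1) r Ss1) ?mulr1 ?mul1r //.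
by apply: frac_den_eq; rewrite mulr1.
Qed.

Lemma loc_mulr1 : right_id (to_loc 1) loc_mul.
Proof.
move=> x; have [s [Ss [r ->]]] := fracP x.
have S1s : S (1 * s) by rewrite mul1r.
rewrite (loc_mulE (c := 1) (d := r) 1 S1s) ?mulr1 ?mul1r //.
by apply: frac_den_eq; rewrite mul1r.
Qed.

Lemma loc_mulDl : left_distributive loc_mul loc_add.
Proof.
move=> x y z; have [s [Ss [r [u [-> ->]]]]] := frac_common2 x y.
have [t [St [w ->]]] := fracP z.
have [[c d] /= [Sc ecd]] := left_ore_ex r St.
have [[e f] /= [Se eef]] := left_ore_ex (c * u) St.
have Secs : S (e * c * s) by do !apply: left_denM.
have er : e * c * r = e * d * t by rewrite -!mulrA ecd.
have eu : e * c * u = f * t by rewrite -!mulrA eef.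
have eru : e * c * (r + u) = (e * d + f) * t by rewrite mulrDr mulrDl er eu.
rewrite loc_addE (loc_mulE w Secs er) (loc_mulE w Secs eu).
by rewrite (loc_mulE w Secs eru) loc_addE mulrDl.
Qed.

Lemma loc_mulDr : right_distributive loc_mul loc_add.
Proof.
move=> x y z; have [s [Ss [r ->]]] := fracP x.
have [t [St [u [v [-> ->]]]]] := frac_common2 y z.
have [[c d] /= [Sc ecd]] := left_ore_ex r St.
have Scs := left_denM Sc Ss.
rewrite loc_addE !(loc_mulE _ Scs ecd).
by rewrite loc_addE mulrDr.
Qed.

Lemma loc_1neq0 : to_loc 1 != to_loc 0.
Proof.
apply/eqP => /frac_eqP[c [d [Sc e]]]; rewrite !mulr1 mulr0 => c0.
by case: denS => -[[_ n0 _] _] _; apply: n0; rewrite -c0 -[c]mulr1.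
Qed.

HB.instance Definition _ := GRing.isZmodule.Build left_loc
  loc_addA loc_addC loc_add0 loc_addN.
HB.instance Definition _ := GRing.Zmodule_isNzRing.Build left_loc
  loc_mulA loc_mul1 loc_mulr1 loc_mulDl loc_mulDr loc_1neq0.

Lemma to_loc_is_zmod_morphism : zmod_morphism to_loc.
Proof.
by move=> r u; rewrite -[RHS]/(loc_add _ (loc_opp _)) loc_oppE loc_addE.
Qed.

Lemma to_loc_is_monoid_morphism : monoid_morphism to_loc.
Proof.
split=> // r u; rewrite -[RHS]/(loc_mul _ _).
have S11 := left_denM left_den1 left_den1.
rewrite (loc_mulE (c := 1) (d := r) u S11) ?mul1r ?mulr1 //.
by apply: frac_den_eq; rewrite mul1r.
Qed.

HB.instance Definition _ :=
  GRing.isZmodMorphism.Build R left_loc to_loc to_loc_is_zmod_morphism.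
HB.instance Definition _ :=
  GRing.isMonoidMorphism.Build R left_loc to_loc to_loc_is_monoid_morphism.

(* The class of (s, r) really is s^-1 r: the image of s is invertible, with
   inverse the class of (s, 1). *)
Lemma left_fracE s (Ss : S s) r : left_frac Ss r = left_frac Ss 1 * to_loc r.
Proof.
rewrite -[RHS]/(loc_mul _ _); have S1s : S (1 * s) by rewrite mul1r.
rewrite (loc_mulE (c := 1) (d := 1) r S1s) // [1 * r]mul1r.
by apply: frac_den_eq; rewrite mul1r.
Qed.

Lemma frac_mulVr s (Ss : S s) : left_frac Ss 1 * to_loc s = 1.
Proof.
rewrite -left_fracE -[RHS]/(left_frac left_den1 1).
by apply/frac_eqP; exists 1, s; rewrite !mul1r mulr1.
Qed.

Lemma frac_divrr s (Ss : S s) : to_loc s * left_frac Ss 1 = 1.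
Proof.
rewrite -[LHS]/(loc_mul _ _); have S11 := left_denM left_den1 left_den1.
rewrite (loc_mulE (c := 1) (d := 1) 1 S11) // -[RHS]/(left_frac left_den1 1).
apply/frac_eqP; exists 1, 1; rewrite !mul1r.
by split=> //; apply: left_den1.
Qed.

Lemma to_loc_eq0 r : to_loc r = 0 <-> ass S r.
Proof.
split=> [/frac_eqP[c [d [Sc _ e]]]|[s Ss sr0]].
  by exists c; [rewrite mulr1 in Sc | rewrite e mulr0].
by apply/frac_eqP; exists s, s; rewrite sr0 mulr0 mulr1.
Qed.

End LeftLocalization.

Section ProductRing.
Variables (n : nat) (R : 'I_n.+1 -> nzRingType).

(* Direct product of nonzero rings, indexed by a nonempty set so that 1 != 0. *)
Definition prod_ring : Type := {dffun forall i, R i}.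
HB.instance Definition _ := Choice.on prod_ring.

Definition prod_ring_app (x : prod_ring) : forall i, R i :=
  fun_of_fin (x : {dffun forall i, R i}).
Coercion prod_ring_app : prod_ring >-> Funclass.

Definition to_prod (f : forall i, R i) : prod_ring := finfun f.

Lemma to_prodE f i : to_prod f i = f i.
Proof. exact: ffunE. Qed.

Lemma prod_ringP (x y : prod_ring) : (forall i, x i = y i) <-> x = y.
Proof. by split=> [e|-> //]; apply/ffunP. Qed.

Let add (x y : prod_ring) := to_prod (fun i => x i + y i).
Let opp (x : prod_ring) := to_prod (fun i => - x i).
Let mul (x y : prod_ring) := to_prod (fun i => x i * y i).
Let zero := to_prod (fun=> 0).
Let one := to_prod (fun=> 1).

Fact prod_addA : associative add.
Proof. by move=> x y z; apply/prod_ringP => i; rewrite !to_prodE addrA. Qed.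
Fact prod_addC : commutative add.
Proof. by move=> x y; apply/prod_ringP => i; rewrite !to_prodE addrC. Qed.
Fact prod_add0 : left_id zero add.
Proof. by move=> x; apply/prod_ringP => i; rewrite !to_prodE add0r. Qed.
Fact prod_addN : left_inverse zero opp add.
Proof. by move=> x; apply/prod_ringP => i; rewrite !to_prodE addNr. Qed.
Fact prod_mulA : associative mul.
Proof. by move=> x y z; apply/prod_ringP => i; rewrite !to_prodE mulrA. Qed.
Fact prod_mul1 : left_id one mul.
Proof. by move=> x; apply/prod_ringP => i; rewrite !to_prodE mul1r. Qed.
Fact prod_mulr1 : right_id one mul.
Proof. by move=> x; apply/prod_ringP => i; rewrite !to_prodE mulr1. Qed.
Fact prod_mulDl : left_distributive mul add.
Proof. by move=> x y z; apply/prod_ringP => i; rewrite !to_prodE mulrDl. Qed.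
Fact prod_mulDr : right_distributive mul add.
Proof. by move=> x y z; apply/prod_ringP => i; rewrite !to_prodE mulrDr. Qed.
Fact prod_1neq0 : one != zero.
Proof.
apply/eqP => /prod_ringP/(_ ord0); rewrite !to_prodE.
exact/eqP/oner_neq0.
Qed.

HB.instance Definition _ := GRing.isZmodule.Build prod_ring
  prod_addA prod_addC prod_add0 prod_addN.
HB.instance Definition _ := GRing.Zmodule_isNzRing.Build prod_ring
  prod_mulA prod_mul1 prod_mulr1 prod_mulDl prod_mulDr prod_1neq0.

Lemma prod_ringD (x y : prod_ring) i : (x + y) i = x i + y i.
Proof. exact: to_prodE. Qed.
Lemma prod_ringM (x y : prod_ring) i : (x * y) i = x i * y i.
Proof. exact: to_prodE. Qed.
Lemma prod_ringN (x : prod_ring) i : (- x) i = - x i.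
Proof. exact: to_prodE. Qed.
Lemma prod_ring0 i : (0 : prod_ring) i = 0.
Proof. exact: to_prodE. Qed.
Lemma prod_ring1 i : (1 : prod_ring) i = 1.
Proof. exact: to_prodE. Qed.

Definition box (A : forall i, set (R i)) : set prod_ring :=
  [set x | forall i, A i (x i)].

(* R_1 x ... x A x ... x R_n, with A in the i-th place. *)
Definition slot (i : 'I_n.+1) (A : set (R i)) : set prod_ring :=
  box (dfwith (fun j => [set: R j]) A).

(* 0 x ... x A x ... x 0, with A in the i-th place. *)
Definition slot0 (i : 'I_n.+1) (A : set (R i)) : set prod_ring :=
  box (dfwith (fun j => [set 0 : R j]) A).

End ProductRing.

(* Main.v *)
Require Import Defs.
From HB Require Import structures.
From mathcomp Require Import all_boot all_order all_algebra.
From mathcomp Require Import boolp classical_sets functions.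

(** Let [pi_i] be the projection of the product ring [P] onto [R_i], and let
    [slot S] be the preimage of [S] under [pi_i].  Elements supported on one
    coordinate carry the whole argument: multiplication by such an element
    only sees that coordinate, so an identity in [R_i] becomes an identity in
    [P] (lemmas [inj_mull] and [inj_mulr]).

    Preimages of left denominator sets under [pi_i] are therefore left
    denominator sets ([slot_left_den]), and so is [pi_i(T)] for a left
    denominator set [T] of [P], provided that [0] is not in [pi_i(T)]
    ([proj_left_den]).  This proviso holds for at least one [i]: otherwise [T]
    would contain, for each [i], an element vanishing at [i], and the product
    of these elements would be [0] ([proj_avoids0]).  Hence every [T] is
    contained in [slot (pi_i(T))] for some [i], with equality when [T] is
    maximal, and maximality passes between [S] and [slot S] because [slot] is
    injective and monotone.  Finally [slot S] contains the idempotent of the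
    [i]-th factor, which vanishes at every other place, so [i] is determined
    by any left denominator set containing [slot S]: this yields both the
    maximality of [slot S] and the disjointness of the images.

    The isomorphism of localizations is the map induced by [pi_i].  A ring
    morphism sending [S] into [S'] induces a map of localizations, which is
    bijective as soon as the morphism is onto, maps [S] onto [S'], and pulls
    [ass S'] back into [ass S] ([left_loc_iso]).  The projection
    satisfies all this, since [ass (slot S) = slot (ass S)]. *)

Set Implicit Arguments.
Unset Strict Implicit.
Unset Printing Implicit Defensive.

Import GRing.Theory.
Local Open Scope classical_set_scope.
Local Open Scope ring_scope.

(** * Functoriality of the left localization *)

Section LocalizationMap.
Variables (R R' : nzRingType) (phi : {rmorphism R -> R'}).
Variables (S : set R) (S' : set R').
Hypotheses (denS : left_denominator_set S) (denS' : left_denominator_set S').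
Hypothesis phiS : forall s, S s -> S' (phi s).

Definition loc_map (x : left_loc denS) : left_loc denS' :=
  left_frac denS' (phiS (den_mem x)) (phi (num x)).

Lemma loc_map_frac s (Ss : S s) r :
  loc_map (left_frac denS Ss r) = left_frac denS' (phiS Ss) (phi r).
Proof.
have /frac_eqP[c [d [Sc e1 e2]]] := frac_num_den (left_frac denS Ss r).
apply/frac_eqP; exists (phi c), (phi d); rewrite -!rmorphM e1 e2.
by split=> //; rewrite -e1; apply: phiS.
Qed.

Lemma loc_map_zmod : zmod_morphism loc_map.
Proof.
move=> x y; have [s [Ss [r [u [-> ->]]]]] := frac_common2 x y.
rewrite -[X in loc_map X]/(loc_add _ (loc_opp _)).
rewrite -[RHS]/(loc_add _ (loc_opp _)).
by rewrite loc_oppE loc_addE !loc_map_frac loc_oppE loc_addE rmorphB.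
Qed.

Lemma loc_map_monoid : monoid_morphism loc_map.
Proof.
split.
  rewrite -[X in loc_map X]/(left_frac denS (left_den1 denS) 1) loc_map_frac.
  apply/frac_eqP; exists 1, 1; rewrite !mul1r rmorph1.
  by split=> //; apply: left_den1.
move=> x y; have [s [Ss [r ->]]] := fracP x; have [t [St [u ->]]] := fracP y.
have [[c d] /= [Sc ecd]] := left_ore_ex denS r St.
have Scs := left_denM denS Sc Ss; have S'cs := phiS Scs.
have S'cs' : S' (phi c * phi s) by rewrite -rmorphM.
have e' : phi c * phi r = phi d * phi t by rewrite -!rmorphM ecd.
rewrite -[X in loc_map X]/(loc_mul _ _) -[RHS]/(loc_mul _ _).
rewrite (loc_mulE denS Ss St u Scs ecd) !loc_map_frac.
rewrite (loc_mulE denS' (phiS Ss) (phiS St) (phi u) S'cs' e').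
by rewrite (rmorphM phi d u); apply: frac_den_eq; rewrite rmorphM.
Qed.

HB.instance Definition _ := GRing.isZmodMorphism.Build
  (left_loc denS) (left_loc denS') loc_map loc_map_zmod.
HB.instance Definition _ := GRing.isMonoidMorphism.Build
  (left_loc denS) (left_loc denS') loc_map loc_map_monoid.

(** Surjectivity lifts numerator and denominator separately.  For injectivity
    it is enough to look at the kernel: [s^-1 r] vanishes exactly when [r]
    does in the localization, that is when [r] lies in [ass S]. *)
Lemma left_loc_iso :
    (forall r', exists r, phi r = r') -> S' `<=` phi @` S ->
    (forall r, ass S' (phi r) -> ass S r) ->
  exists f : {rmorphism left_loc denS -> left_loc denS'}, bijective f.
Proof.
move=> surj surjS ass_phi; exists loc_map.
have inj : injective loc_map.
  apply: raddf_inj => x /=; have [s [Ss [r ->]]] := fracP x.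
  rewrite loc_map_frac left_fracE => /(congr1 ( *%R (to_loc denS' (phi s)))).
  rewrite mulrA frac_divrr mul1r mulr0 => /to_loc_eq0/ass_phi/(to_loc_eq0 denS).
  by rewrite left_fracE => ->; rewrite mulr0.
have onto y : exists x, loc_map x = y.
  have [s' [Ss' [r' ->]]] := fracP y.
  have [s Ss es] := surjS _ Ss'; have [r er] := surj r'.
  exists (left_frac denS Ss r); rewrite loc_map_frac er.
  exact: frac_den_eq.
exists (fun y => sval (cid (onto y))) => [x|y]; last by case: cid.
by apply: inj; case: cid.
Qed.

End LocalizationMap.

(** * One coordinate of a product ring *)

Section Product.
Variables (n : nat) (R : 'I_n.+1 -> nzRingType).
Implicit Types (i j : 'I_n.+1) (x y : prod_ring R) (T : set (prod_ring R)).

(* The coercion is written out: on a sum or a product, an implicit one would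
   unfold to the coercion of the underlying finite function. *)
Lemma coordB i x y : prod_ring_app (x - y) i = x i - y i.
Proof. by rewrite [LHS]prod_ringD -prod_ringN. Qed.

Lemma coordM i x y : prod_ring_app (x * y) i = x i * y i.
Proof. exact: prod_ringM. Qed.

Lemma coord0 i : prod_ring_app (0 : prod_ring R) i = 0.
Proof. exact: prod_ring0. Qed.

Lemma coord1 i : prod_ring_app (1 : prod_ring R) i = 1.
Proof. exact: prod_ring1. Qed.

Definition proj i x : R i := x i.

Lemma proj_is_zmod_morphism i : zmod_morphism (proj i).
Proof. by move=> x y; rewrite /proj coordB. Qed.

Lemma proj_is_monoid_morphism i : monoid_morphism (proj i).
Proof. by split=> [|x y]; rewrite /proj ?coord1 ?coordM. Qed.

HB.instance Definition _ i := GRing.isZmodMorphism.Build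
  (prod_ring R) (R i) (proj i) (proj_is_zmod_morphism i).
HB.instance Definition _ i := GRing.isMonoidMorphism.Build
  (prod_ring R) (R i) (proj i) (proj_is_monoid_morphism i).

Definition inj i (r : R i) : prod_ring R :=
  to_prod (dfwith (fun j => 0 : R j) r).

Lemma injE i (r : R i) : inj r i = r.
Proof. by rewrite to_prodE dfwith_in. Qed.

Lemma inj_neq i j (r : R i) : j != i -> inj r j = 0.
Proof. by move=> ji; rewrite to_prodE dfwith_out // eq_sym. Qed.

Lemma inj0 i : inj (0 : R i) = 0.
Proof.
apply/prod_ringP => j; rewrite coord0.
by have [->|ji] := eqVneq j i; rewrite ?injE ?inj_neq.
Qed.

Lemma inj_mull i (r : R i) x : inj r * x = inj (r * x i).
Proof.
apply/prod_ringP => j; rewrite coordM.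
by have [->|ji] := eqVneq j i; rewrite ?injE // !inj_neq ?mul0r.
Qed.

Lemma inj_mulr i (r : R i) x : x * inj r = inj (x i * r).
Proof.
apply/prod_ringP => j; rewrite coordM.
by have [->|ji] := eqVneq j i; rewrite ?injE // !inj_neq ?mulr0.
Qed.

Lemma slotP i (S : set (R i)) x : slot S x <-> S (x i).
Proof.
split=> [/(_ i)|Sx j]; first by rewrite dfwith_in.
have [->|ji] := eqVneq j i; first by rewrite dfwith_in.
by rewrite dfwith_out // eq_sym.
Qed.

Lemma slot0P i (S : set (R i)) x :
  slot0 S x <-> S (x i) /\ forall j, j != i -> x j = 0.
Proof.
split=> [Sx|[Sx x0] j].
  split=> [|j ji]; first by have := Sx i; rewrite dfwith_in.
  by have := Sx j; rewrite dfwith_out // eq_sym.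
have [->|ji] := eqVneq j i; first by rewrite dfwith_in.
by rewrite dfwith_out ?x0 // eq_sym.
Qed.

Lemma slot_inj i (S : set (R i)) r : S r -> slot S (inj r).
Proof. by move=> Sr; apply/slotP; rewrite injE. Qed.

Lemma subset_slot i (S S' : set (R i)) : S `<=` S' -> slot S `<=` slot S'.
Proof. by move=> SS' x /slotP/SS' Sx; apply/slotP. Qed.

Lemma slot_injective i : injective (@slot n R i).
Proof.
move=> S S' e; apply/seteqP.
by split=> r /slot_inj; [rewrite e | rewrite -e] => /slotP; rewrite injE.
Qed.

Lemma ass_slot i (S : set (R i)) : ass (slot S) = slot (ass S).
Proof.
apply/seteqP; split=> x.
  case=> s /slotP Ss sx0; apply/slotP; exists (s i) => //.
  by rewrite -coordM sx0 coord0.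
case/slotP => s Ss sx0; exists (inj s); first exact: slot_inj.
by rewrite inj_mull sx0 inj0.
Qed.

(** * Left denominator sets of a product ring *)

Lemma slot_left_den i (S : set (R i)) :
  left_denominator_set S -> left_denominator_set (slot S).
Proof.
move=> denS; have [[[S1 S0 SM] _] denr] := denS; split; first split.
- split=> [||s t /slotP Ss /slotP St].
  + by apply/slotP; rewrite coord1.
  + by move=> /slotP; rewrite coord0.
  + by apply/slotP; rewrite coordM; apply: SM.
- move=> r s /slotP Ss.
  have [[a b] /= [Sa e]] := left_ore_ex denS (r i) Ss.
  exists (inj a * r); split; first by exists (inj a) => //; apply: slot_inj.
  by exists (inj b) => //; rewrite !inj_mull e.
- move=> r s /slotP Ss rs0; rewrite ass_slot; apply/slotP.
  by apply: (denr _ (s i)) => //; rewrite -coordM rs0 coord0.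
Qed.

(** Equations in [R i] involving elements of the projection of [T] are lifted
    to [P] by placing the arbitrary ring element at the [i]-th place; [T]
    itself then provides the missing denominators. *)
Lemma proj_left_den i T : left_denominator_set T -> ~ (proj i @` T) 0 ->
  left_denominator_set (proj i @` T).
Proof.
move=> denT T0; have [[[T1 _ TM] _] denr] := denT; split; first split.
- split=> //; first by exists 1 => //; rewrite rmorph1.
  move=> _ _ [s Ts <-] [t Tt <-].
  by exists (s * t); rewrite ?rmorphM //; apply: TM.
- move=> r _ [s Ts <-].
  have [[a b] /= [Ta e]] := left_ore_ex denT (inj r) Ts.
  have er : proj i (inj r) = r by exact: injE.
  exists (proj i a * r); split; first by exists (proj i a) => //; exists a.
  by exists (proj i b) => //; rewrite -rmorphM -e rmorphM /= er.
- move=> r _ [s Ts <-] rs0.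
  have [|t Tt tr0] := denr (inj r) s Ts; first by rewrite inj_mull rs0 inj0.
  exists (proj i t); first by exists t.
  by rewrite -[r]injE -[inj r i]/(proj i (inj r)) -rmorphM tr0 rmorph0.
Qed.

Lemma proj_avoids0 T : left_denominator_set T -> exists i, ~ (proj i @` T) 0.
Proof.
case=> -[[T1 T0 TM] _] _; apply: contrapT => /forallNP vanish.
have /choice[t Tt] : forall i, exists t, T t /\ t i = 0.
  by move=> i; have /contrapT[t Tt ti] := vanish i; exists t.
apply: T0; suff <- : \prod_i t i = 0.
  by elim/big_ind: _ => // i _; case: (Tt i).
apply/prod_ringP => i; rewrite coord0.
have := mem_index_enum i; elim: (index_enum _) => // j s IHs.
rewrite inE big_cons coordM => /predU1P[<-|/IHs ->]; last by rewrite mulr0.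
by rewrite (Tt i).2 mul0r.
Qed.

Lemma sub_slot_proj i T : T `<=` slot (proj i @` T).
Proof. by move=> x Tx; apply/slotP; exists x. Qed.

(** Some projection of [T] avoids [0], and it can only be the [i]-th one: the
    idempotent of the [i]-th factor lies in [slot S], hence in [T], and it
    vanishes at all other places. *)
Lemma proj_avoids0_slot i (S : set (R i)) T :
    S 1 -> left_denominator_set T -> slot S `<=` T -> ~ (proj i @` T) 0.
Proof.
move=> S1 denT ST; have [j T0] := proj_avoids0 denT.
have [<- //|ji] := eqVneq j i.
by case: T0; exists (inj (1 : R i)); [apply/ST/slot_inj | apply: inj_neq].
Qed.

Lemma max_left_den_slot i (S : set (R i)) :
  max_left_den S -> max_left_den (slot S).
Proof.
move=> [denS maxS]; split=> [|T denT ST]; first exact: slot_left_den.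
have T0 := proj_avoids0_slot (left_den1 denS) denT ST.
have eT : proj i @` T = S.
  apply: maxS; first exact: proj_left_den.
  by move=> s /slot_inj/ST Ts; exists (inj s) => //; apply: injE.
by apply/seteqP; split=> //; rewrite -eT; apply: sub_slot_proj.
Qed.

Lemma max_left_den_slotV i (S : set (R i)) :
  left_denominator_set S -> max_left_den (slot S) -> max_left_den S.
Proof.
move=> denS [_ maxS]; split=> // S' denS' SS'; apply: slot_injective.
by apply: maxS; [apply: slot_left_den | apply: subset_slot].
Qed.

Lemma max_left_den_prodE :
  @max_left_den (prod_ring R) = \bigcup_i (@slot n R i @` @max_left_den (R i)).
Proof.
apply/seteqP; split=> [T maxT|_ [i _ [S maxS <-]]]; last first.
  exact: max_left_den_slot.
have [denT max] := maxT; have [i T0] := proj_avoids0 denT.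
have denTi := proj_left_den denT T0.
have eT := max _ (slot_left_den denTi) (@sub_slot_proj i T).
exists i => //; exists (proj i @` T) => //.
by apply: max_left_den_slotV; rewrite ?eT.
Qed.

Lemma trivIset_slot :
  trivIset [set: 'I_n.+1] (fun i => @slot n R i @` @max_left_den (R i)).
Proof.
move=> i j _ _ [X [[S [denS _] <-] [S' [denS' _] e]]].
apply: contrapT => /eqP ij; have [[[_ S'0 _] _] _] := denS'; apply: S'0.
have := slot_inj (left_den1 denS); rewrite -e => /slotP.
by rewrite inj_neq // eq_sym.
Qed.

(** The kernel of left multiplication by [x] is computed coordinatewise, and it
    has to be [slot (ass S)]; away from the [i]-th place, [x j] must then
    annihilate all of [R j], in particular [1], so that [x j = 0]. *)
Lemma ore_core_slot i (S : set (R i)) : ore_core (slot S) = slot0 (ore_core S).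
Proof.
apply/seteqP; split=> x; rewrite /ore_core ass_slot.
  move=> [/slotP Sx kerx].
  have kerxE r : x * r = 0 <-> slot (ass S) r by rewrite -kerx.
  apply/slot0P; split=> [|j ji].
    split=> //; apply/seteqP; split=> r.
      move=> xr0; have /kerxE/slotP : x * inj r = 0.
        by rewrite inj_mulr xr0 inj0.
      by rewrite injE.
    move=> /slot_inj/kerxE; rewrite inj_mulr => /prod_ringP/(_ i).
    by rewrite injE coord0.
  have : slot (ass S) (inj (1 : R j)).
    by apply/slotP; rewrite inj_neq 1?eq_sym //; exists (x i); rewrite ?mulr0.
  by move=> /kerxE/prod_ringP/(_ j); rewrite inj_mulr mulr1 injE coord0.
case/slot0P => -[Sx kerx] x0; split; first exact/slotP.
apply/seteqP; split=> r.
  move=> /prod_ringP/(_ i); rewrite coordM coord0 => xr0.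
  by apply/slotP; rewrite -kerx.
move=> /slotP; rewrite -kerx => xr0; apply/prod_ringP => j.
rewrite coordM coord0.
by have [->|/x0 ->] := eqVneq j i; rewrite ?mul0r.
Qed.

Lemma left_loc_slot_iso i (S : set (R i))
    (denS : left_denominator_set S) (denP : left_denominator_set (slot S)) :
  exists f : {rmorphism left_loc denP -> left_loc denS}, bijective f.
Proof.
apply: (@left_loc_iso _ _ (proj i)) => [s /slotP //|r|s Ss|r].
- by exists (inj r); apply: injE.
- by exists (inj s); [apply: slot_inj | apply: injE].
- by move=> assr; rewrite ass_slot; apply/slotP.
Qed.

End Product.

Theorem theorem2p9 (n : nat) (R : 'I_n.+1 -> nzRingType) :
  [/\ forall (i : 'I_n.+1) (S : set (R i)),
        max_left_den S -> max_left_den (slot S),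
      forall i : 'I_n.+1,
        set_inj (@max_left_den (R i)) (@slot n R i),
      trivIset [set: 'I_n.+1] (fun i => @slot n R i @` @max_left_den (R i)),
      @max_left_den (prod_ring R)
        = \bigcup_i (@slot n R i @` @max_left_den (R i))
    & forall (i : 'I_n.+1) (S : set (R i)), max_left_den S ->
        [/\ forall (denS : left_denominator_set S)
                   (denP : left_denominator_set (slot S)),
              exists f : {rmorphism left_loc denP -> left_loc denS},
                bijective f,
            ass (slot S) = slot (ass S)
          & ore_core (slot S) = slot0 (ore_core S)]].

Proof.
split.
- exact: max_left_den_slot.
- by move=> i S S' _ _; apply: slot_injective.
- exact: trivIset_slot.
- exact: max_left_den_prodE.
- move=> i S _; split; last exact: ore_core_slot.
    exact: left_loc_slot_iso.
  exact: ass_slot.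
Qed.
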